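(* Let $c_1<c_2$ and $\delta>0$ be real scalars, let $\Gamma$ be an $n\times n$ real symmetric positive definite matrix, let $\varrho:[c_1,c_2]\to\mathbb{R}^n$ be a function (square integrable, so that the integrals below exist), and let $\hat m$ be a nonnegative integer. Let $g_0,\dots,g_{\hat m}$ be nonzero real polynomials that are pairwise orthogonal for the weighted inner product $\langle f,g\rangle_w=\int_{c_1}^{c_2}e^{-\delta(v-c_2)}f(v)g(v)\,dv$. Then $$\int_{c_1}^{c_2} e^{\delta(v-c_2)}\varrho^T(v)\,\Gamma\,\varrho(v)\,dv\;\ge\;\sum_{k=0}^{\hat m}\frac{1}{\langle g_k,g_k\rangle_w}\left(\int_{c_1}^{c_2}g_k(v)\varrho(v)\,dv\right)^T\Gamma\left(\int_{c_1}^{c_2}g_k(v)\varrho(v)\,dv\right).$$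
   Context: The weight in the integral on the left-hand side is $e^{\delta(v-c_2)}$, whereas the inner product $\langle\cdot,\cdot\rangle_w$ uses the reciprocal weight $e^{-\delta(v-c_2)}$. *)

(* Defs.v *)
From HB Require Import structures.
From mathcomp Require Import all_boot all_order all_algebra.
From mathcomp Require Import all_classical all_reals all_analysis.

Set Implicit Arguments.
Unset Strict Implicit.
Unset Printing Implicit Defensive.

Import Order.TTheory GRing.Theory Num.Theory.
Import numFieldNormedType.Exports.

Local Open Scope classical_set_scope.
Local Open Scope ring_scope.

(* The real line with the Lebesgue sigma-algebra. The Borel sigma-algebra used
   by [lebesgue_measure] would exclude the square-integrable functions that are
   not Borel measurable. *)
Notation lebesgue_line R :=
  (caratheodory_type (measure_extension.mu_ext (@wlength R idfun))).

Notation leb := (@completed_lebesgue_measure _).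

Definition posdefmx (R : realType) (n : nat) (A : 'M[R]_n) : Prop :=
  A \is symmetricmx /\ forall x : 'cV[R]_n, x != 0 -> 0 < (x^T *m A *m x) 0 0.

(* Only the values of [rho] on [a, b] matter. *)
Definition square_integrable (R : realType) (n : nat) (a b : R)
    (rho : R -> 'cV[R]_n) : Prop :=
  forall i : 'I_n,
    measurable_fun (`[a, b] : set (lebesgue_line R)) (fun v => rho v i 0) /\
    leb.-integrable `[a, b] (fun v => ((rho v i 0) ^+ 2)%:E).

Definition weighted_inner (R : realType) (a b delta : R) (f g : R -> R) : R :=
  \int[leb]_(v in `[a, b]) (expR (- delta * (v - b)) * f v * g v).

Definition vector_integral (R : realType) (n : nat) (a b : R)
    (F : R -> 'cV[R]_n) : 'cV[R]_n :=
  \col_i \int[leb]_(v in `[a, b]) F v i 0.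

(* Main.v *)
(* A weighted Bessel inequality. Put w(v) = e^{-delta(v - c2)}, N_k = <g_k, g_k>_w
   and G_k = \int g_k rho, and let s = \sum_k N_k^{-1} g_k G_k. Integrating the
   nonnegative function w^{-1} (rho - w s)^T Gamma (rho - w s) gives
   \int w^{-1} rho^T Gamma rho - 2 S + S >= 0 with
   S = \sum_k N_k^{-1} G_k^T Gamma G_k: the weight cancels in the cross term,
   and orthogonality collapses the double sum of the last term. *)
Require Import Defs.
From HB Require Import structures.
From mathcomp Require Import all_boot all_order all_algebra.
From mathcomp Require Import all_classical all_reals all_analysis.
From mathcomp Require Import ring lra.

Set Implicit Arguments.
Unset Strict Implicit.
Unset Printing Implicit Defensive.

Import Order.TTheory GRing.Theory Num.Theory.
Import numFieldNormedType.Exports.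

Local Open Scope classical_set_scope.
Local Open Scope ring_scope.

(** * Bilinear form of a square matrix *)

Section BilinearForm.
Context (R : realType) (n : nat) (A : 'M[R]_n).
Implicit Types (x y z : 'cV[R]_n) (a : R).

Definition bform x y : R := (x^T *m A *m y) 0 0.

Lemma bformDl x y z : bform (x + y) z = bform x z + bform y z.
Proof. by rewrite /bform linearD/= !mulmxDl mxE. Qed.

Lemma bformDr x y z : bform z (x + y) = bform z x + bform z y.
Proof. by rewrite /bform mulmxDr mxE. Qed.

Lemma bformZl a x y : bform (a *: x) y = a * bform x y.
Proof. by rewrite /bform linearZ/= -!scalemxAl mxE. Qed.

Lemma bformZr a x y : bform x (a *: y) = a * bform x y.
Proof. by rewrite /bform -!scalemxAr mxE. Qed.

Lemma bform_suml I (s : seq I) (F : I -> 'cV[R]_n) y :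
  bform (\sum_(i <- s) F i) y = \sum_(i <- s) bform (F i) y.
Proof. by rewrite /bform linear_sum/= !mulmx_suml summxE. Qed.

Lemma bform_sumr I (s : seq I) (F : I -> 'cV[R]_n) y :
  bform y (\sum_(i <- s) F i) = \sum_(i <- s) bform y (F i).
Proof. by rewrite /bform mulmx_sumr summxE. Qed.

Lemma bformE x y : bform x y = \sum_i \sum_j A i j * (x i 0 * y j 0).
Proof.
rewrite /bform -mulmxA mxE; apply: eq_bigr => i _.
rewrite !mxE mulr_sumr; apply: eq_bigr => j _; ring.
Qed.

(** With [y] fixed the form is linear in the entries of [x], so it commutes with entrywise
    integration of [x]. *)
Lemma bform_coordl x y : bform x y = \sum_i (A *m y) i 0 * x i 0.
Proof.
by rewrite /bform -mulmxA mxE; apply: eq_bigr => i _; rewrite !mxE mulrC.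
Qed.

Lemma bformC x y : A \is symmetricmx -> bform x y = bform y x.
Proof.
(* Symmetric means Hermitian with sign [(-1) ^+ 0] and trivial conjugation; erasing both leaves
   [A = A^T]. *)
move=> /is_hermitianmxP; rewrite expr0 scale1r map_mx_id// => AT.
transitivity ((x^T *m A *m y)^T 0 0); first by rewrite mxE.
by rewrite !trmx_mul trmxK -AT mulmxA.
Qed.

Lemma posdefmx_bform_ge0 x : posdefmx A -> 0 <= bform x x.
Proof.
move=> [_ Apos]; have [->|x0] := eqVneq x 0; last exact/ltW/Apos.
by rewrite /bform mulmx0 mxE.
Qed.

End BilinearForm.

(** * Integrals of finite linear combinations *)

Section HasIntegral.
Context d (T : measurableType d) (R : realType).
Context (mu : {measure set T -> \bar R}) (D : set T) (mD : measurable D).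
Implicit Types f g : T -> R.

(** Linearity of [Rintegral] requires integrability, so the two are carried together and each rule
    derives both at once. *)
Definition has_integral f (r : R) : Prop :=
  mu.-integrable D (EFin \o f) /\ \int[mu]_(v in D) f v = r.

Lemma has_integral_eq f g r :
  {in D, f =1 g} -> has_integral f r -> has_integral g r.
Proof.
move=> fg [intf <-]; split; last by apply: eq_Rintegral => x xD; rewrite fg.
by apply: eq_integrable intf => // x xD /=; rewrite fg.
Qed.

Lemma has_integralD f g r s : has_integral f r -> has_integral g s ->
  has_integral (fun v => f v + g v) (r + s).
Proof.
move=> [intf <-] [intg <-]; split; last by rewrite RintegralD.
exact: (integrableD mD intf intg).
Qed.

Lemma has_integralZ a f r :
  has_integral f r -> has_integral (fun v => a * f v) (a * r).
Proof.
move=> [intf <-]; split; last by rewrite RintegralZl.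
exact: (integrableZl mD a intf).
Qed.

Lemma has_integral_sum I (s : seq I) (f : I -> T -> R) (r : I -> R) :
  (forall i, has_integral (f i) (r i)) ->
  has_integral (fun v => \sum_(i <- s) f i v) (\sum_(i <- s) r i).
Proof.
move=> fr; elim: s => [|i s IHs].
  rewrite big_nil; apply: (@has_integral_eq (cst 0)).
    by move=> v _; rewrite big_nil.
  split; first exact: integrable0.
  by rewrite /Rintegral integral0.
rewrite big_cons; apply: has_integral_eq (has_integralD (fr i) IHs).
by move=> v _; rewrite big_cons.
Qed.

End HasIntegral.

(** Separates the algebra from the analysis: the weights are any reciprocal pair [u], [w], and
    integrability is assumed entry by entry. *)
Lemma bessel_posdefmx d (T : measurableType d) (R : realType)
    (mu : {measure set T -> \bar R}) (D : set T) (n m : nat)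
    (A : 'M[R]_n) (u w : T -> R) (rho : T -> 'cV[R]_n) (g : 'I_m -> T -> R)
    (norm2 := fun k => \int[mu]_(v in D) (w v * g k v * g k v))
    (G := fun k => \col_i \int[mu]_(v in D) (g k v * rho v i 0)) :
  measurable D -> posdefmx A ->
  (forall v, 0 <= u v) -> (forall v, u v * w v = 1) ->
  (forall i j, mu.-integrable D (fun v => (u v * (rho v i 0 * rho v j 0))%:E)) ->
  (forall k i, mu.-integrable D (fun v => (g k v * rho v i 0)%:E)) ->
  (forall j k, mu.-integrable D (fun v => (w v * g j v * g k v)%:E)) ->
  (forall j k, j != k -> \int[mu]_(v in D) (w v * g j v * g k v) = 0) ->
  \sum_(k < m) 1 / norm2 k * bform A (G k) (G k)
    <= \int[mu]_(v in D) (u v * bform A (rho v) (rho v)).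
Proof.
move=> mD Apd u0 uw int_rho int_g_rho int_g g_orth.
have Asym := Apd.1.
pose c k := (norm2 k)^-1.
pose s v := \sum_k (c k * g k v) *: G k.
set S := \sum_(k < m) _; set I := Rintegral _ _ _.
have rho_rho : has_integral mu D (fun v => u v * bform A (rho v) (rho v)) I.
  split=> //=.
  (* Only integrability is at stake, [I] being the integral by definition; the double sum is the
     value that the expansion in entries produces. *)
  suff [] : has_integral mu D (fun v => u v * bform A (rho v) (rho v))
    (\sum_i \sum_j A i j * \int[mu]_(v in D) (u v * (rho v i 0 * rho v j 0))).
    by [].
  pose F i j v := A i j * (u v * (rho v i 0 * rho v j 0)).
  apply: (@has_integral_eq _ _ _ _ _ mD (fun v => \sum_i \sum_j F i j v)).
    move=> v _; rewrite bformE mulr_sumr; apply: eq_bigr => i _.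
    by rewrite mulr_sumr; apply: eq_bigr => j _; rewrite /F; ring.
  apply: has_integral_sum => // i; apply: has_integral_sum => // j.
  by apply: has_integralZ => //; split=> //; exact: int_rho.
have rho_s : has_integral mu D (fun v => bform A (rho v) (s v)) S.
  rewrite /S; pose F k v := c k * (g k v * bform A (rho v) (G k)).
  apply: (@has_integral_eq _ _ _ _ _ mD (fun v => \sum_k F k v)).
    move=> v _; rewrite bform_sumr; apply: eq_bigr => k _.
    by rewrite bformZr /F; ring.
  apply: has_integral_sum => // k; rewrite div1r; apply: has_integralZ => //.
  (* Integrating [g k v * rho v i 0] gives entry [i] of [G k], which rebuilds the form at [G k]. *)
  pose F' i v := (A *m G k) i 0 * (g k v * rho v i 0).
  apply: (@has_integral_eq _ _ _ _ _ mD (fun v => \sum_i F' i v)).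
    move=> v _; rewrite bform_coordl mulr_sumr; apply: eq_bigr => i _.
    by rewrite /F'; ring.
  rewrite bform_coordl; apply: has_integral_sum => // i.
  by apply: has_integralZ => //; split; [exact: int_g_rho|rewrite mxE].
have s_s : has_integral mu D (fun v => w v * bform A (s v) (s v)) S.
  pose F j k v := c j * c k * bform A (G j) (G k) * (w v * g j v * g k v).
  apply: (@has_integral_eq _ _ _ _ _ mD (fun v => \sum_j \sum_k F j k v)).
    move=> v _; rewrite bform_suml mulr_sumr; apply: eq_bigr => j _.
    rewrite bform_sumr mulr_sumr; apply: eq_bigr => k _.
    by rewrite bformZl bformZr /F; ring.
  apply: has_integral_sum => // j.
  (* Orthogonality leaves only [k = j], where [c j * c j * norm2 j = c j]. *)
  have -> : 1 / norm2 j * bform A (G j) (G j) =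
      \sum_k c j * c k * bform A (G j) (G k) *
             \int[mu]_(v in D) (w v * g j v * g k v).
    rewrite (bigD1 j)//= big1 ?addr0; last first.
      by move=> k kj; rewrite g_orth ?mulr0// eq_sym.
    rewrite -/(norm2 j) /c div1r.
    (* A null [g j] is harmless: its coefficient is [0^-1 = 0]. *)
    have [->|N0] := eqVneq (norm2 j) 0; first by rewrite invr0 !mul0r.
    by field.
  apply: has_integral_sum => // k; apply: has_integralZ => //; split=> //.
  exact: int_g.
(* By [u w = 1], the integrand is [u] times the form of [rho - w s]. *)
have [_ resid] := has_integralD mD rho_rho
  (has_integralD mD (has_integralZ mD (- 2) rho_s) s_s).
rewrite -subr_ge0 (_ : I - S = I + (- 2 * S + S)); last by ring.
rewrite -resid; apply: Rintegral_ge0 => v _.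
have -> : u v * bform A (rho v) (rho v)
    + (- 2 * bform A (rho v) (s v) + w v * bform A (s v) (s v))
  = u v * bform A (rho v + (- w v) *: s v) (rho v + (- w v) *: s v).
  rewrite !(bformDl, bformDr, bformZl, bformZr) (bformC (s v) (rho v))//.
  have := uw v; move: (u v) (w v) => a b ab.
  (* The unit [a * b] is inserted where it is missing, so that what remains is a polynomial
     identity. *)
  transitivity (a * bform A (rho v) (rho v)
    + (- 2 * (a * b) * bform A (rho v) (s v)
       + (a * b) * b * bform A (s v) (s v))).
    by rewrite ab mulr1 mul1r.
  by ring.
by rewrite mulr_ge0// posdefmx_bform_ge0.
Qed.

(** * Continuous functions on the Lebesgue line *)

Section LebesgueLine.
Context {R : realType}.
Implicit Types (a b : R) (f h : R -> R).

Lemma lebesgue_line_measurable (X : set (measurableTypeR R)) :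
  measurable X -> measurable (X : set (lebesgue_line R)).
Proof. exact: sub_caratheodory. Qed.

(** Only the domain carries the larger sigma-algebra: the preimage of a Borel set is Borel, hence
    Lebesgue measurable. *)
Lemma continuous_measurable_lebesgue_line (D : set (lebesgue_line R)) h :
  continuous h -> measurable_fun D (h : lebesgue_line R -> R).
Proof.
move=> /measurable_realfun.continuous_measurable_fun mh.
apply: (@measurable_funTS _ _ (lebesgue_line R)) => _ Y mY.
apply: lebesgue_line_measurable; exact: mh.
Qed.

Lemma continuous_bounded_itvcc a b h :
  continuous h -> [bounded h x | x in (`[a, b] : set (lebesgue_line R))].
Proof.
move=> ch; have /compact_bounded[M [_ Mh]] := continuous_compact
  (continuous_subspaceT ch) (@segment_compact R a b).
by exists M; split; rewrite ?num_real // => ? ? ? ?; exact: Mh.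
Qed.

Lemma measurable_lebesgue_line_itvcc a b :
  measurable (`[a, b] : set (lebesgue_line R)).
Proof.
have mab : measurable (`[a, b] : set (measurableTypeR R)).
  exact: measurable_itv.
exact: (lebesgue_line_measurable mab).
Qed.

Lemma lebesgue_line_itvcc_lty a b :
  (@completed_lebesgue_measure R `[a, b] < +oo)%E.
Proof.
(* Both measures are restrictions of the same outer measure. *)
have : (@lebesgue_measure R `[a, b] < +oo)%E.
  exact/compact_finite_measure/segment_compact.
by [].
Qed.

Lemma continuous_integrable_lebesgue_line a b h :
  continuous h -> leb.-integrable `[a, b] (EFin \o h).
Proof.
move=> ch; apply: measurable_bounded_integrable.
- exact: measurable_lebesgue_line_itvcc.
- exact: lebesgue_line_itvcc_lty.
- exact: continuous_measurable_lebesgue_line.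
- exact: continuous_bounded_itvcc.
Qed.

(** A continuous factor is bounded on a compact interval; this absorbs the weight [u] and the
    polynomials. *)
Lemma integrable_continuousM a b h f :
  continuous h -> leb.-integrable `[a, b] (EFin \o f) ->
  leb.-integrable `[a, b] (fun v => (h v * f v)%:E).
Proof.
move=> ch intf; apply: (integrableMr _ _ _ intf).
- exact: measurable_lebesgue_line_itvcc.
- exact: continuous_measurable_lebesgue_line.
- exact: continuous_bounded_itvcc.
Qed.

End LebesgueLine.

(** Domination by [f ^+ 2 + g ^+ 2]. *)
Lemma integrable_mul_sqr d (T : measurableType d) (R : realType)
    (mu : {measure set T -> \bar R}) (D : set T) (f g : T -> R) :
  measurable D -> measurable_fun D f -> measurable_fun D g ->
  mu.-integrable D (fun v => (f v ^+ 2)%:E) ->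
  mu.-integrable D (fun v => (g v ^+ 2)%:E) ->
  mu.-integrable D (fun v => (f v * g v)%:E).
Proof.
move=> mD mf mg intf intg; apply: le_integrable (integrableD mD intf intg) => //.
  apply/measurable_realfun.measurable_EFinP.
  exact: measurable_realfun.measurable_funM.
move=> v _ /=; rewrite lee_fin [leRHS]ger0_norm ?addr_ge0 ?sqr_ge0//.
(* The square of [f v + g v] gives the lower bound, that of [f v - g v] the upper one. *)
rewrite ler_norml; apply/andP; split.
  have := sqr_ge0 (f v + g v); rewrite sqrrD.
  have := sqr_ge0 (f v); have := sqr_ge0 (g v); nra.
have := sqr_ge0 (f v - g v); rewrite sqrrB.
have := sqr_ge0 (f v); have := sqr_ge0 (g v); nra.
Qed.

Theorem lemma2p3 (R : realType) (c1 c2 delta : R) (n : nat) (Gamma : 'M[R]_n)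
    (rho : R -> 'cV[R]_n) (m : nat) (g : 'I_m.+1 -> {poly R})
    (c12 : c1 < c2) (delta_gt0 : 0 < delta)
    (Gamma_posdef : posdefmx Gamma)
    (rho_L2 : square_integrable c1 c2 rho)
    (g_neq0 : forall k, g k != 0)
    (g_orth : forall j k, j != k ->
       weighted_inner c1 c2 delta (horner (g j)) (horner (g k)) = 0) :
  \sum_(k < m.+1)
     1 / weighted_inner c1 c2 delta (horner (g k)) (horner (g k)) *
     ((vector_integral c1 c2 (fun v => (g k).[v] *: rho v))^T *m Gamma *m
      vector_integral c1 c2 (fun v => (g k).[v] *: rho v)) 0 0
  <= \int[leb]_(v in `[c1, c2])
       (expR (delta * (v - c2)) * ((rho v)^T *m Gamma *m rho v) 0 0).
Proof.
pose w (v : R) := expR (- delta * (v - c2)).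
pose u v := expR (delta * (v - c2)).
have aff_cont a : continuous (fun v : R => expR (a * (v - c2))).
  move=> v; apply: (@continuous_comp _ _ _ (fun v : R => a * (v - c2)) expR).
    apply: (@continuousM R R); first exact: cvg_cst.
    by apply: continuousB; [exact: cvg_id|exact: cvg_cst].
  exact: continuous_expR.
have cg k : continuous (horner (g k)) by exact: continuous_horner.
have cM (h1 h2 : R -> R) : continuous h1 -> continuous h2 ->
  continuous (fun v => h1 v * h2 v).
  by move=> ch1 ch2 v; apply: (@continuousM R R); [exact: ch1|exact: ch2].
have mI : measurable (`[c1, c2] : set (lebesgue_line R)).
  exact: measurable_lebesgue_line_itvcc.
have int_prod i j :
    leb.-integrable `[c1, c2] (fun v => (rho v i 0 * rho v j 0)%:E).
  have [[mi Li] [mj Lj]] := (rho_L2 i, rho_L2 j).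
  exact: integrable_mul_sqr.
have int_rho i : leb.-integrable `[c1, c2] (fun v => (rho v i 0)%:E).
  have [mi Li] := rho_L2 i.
  (* On a set of finite measure, square integrable implies integrable: the constant 1 serves as the
     other factor. *)
  have int1 : leb.-integrable `[c1, c2] (fun=> (1 ^+ 2)%:E : \bar R).
    by apply: continuous_integrable_lebesgue_line => v; exact: cvg_cst.
  have := integrable_mul_sqr mI (measurable_cst (1 : R)) mi int1 Li.
  by apply: eq_integrable => // v _; rewrite mul1r.
have GE k : vector_integral c1 c2 (fun v => (g k).[v] *: rho v) =
    \col_i \int[leb]_(v in `[c1, c2]) ((g k).[v] * rho v i 0).
  apply/colP => i; rewrite !mxE; apply: eq_Rintegral => v _.
  by rewrite mxE.
under eq_bigr do rewrite GE.
(* Here [w] is the weight of [weighted_inner], so [g_orth] is the required orthogonality up to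
   unfolding. *)
apply: (@bessel_posdefmx _ _ _ leb _ _ _ _ u w rho (fun k => horner (g k))) => //.
- by move=> v; exact: expR_ge0.
- by move=> v; rewrite /u /w -expRD mulNr subrr expR0.
- by move=> i j; exact: (integrable_continuousM (aff_cont delta) (int_prod i j)).
- by move=> k i; exact: (integrable_continuousM (cg k) (int_rho i)).
- move=> j k; apply: continuous_integrable_lebesgue_line.
  exact: (cM _ _ (cM _ _ (aff_cont (- delta)) (cg j)) (cg k)).
Qed.
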